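(* Let $\sigma$ be a substitution and $\alpha$ a prenaming safe for $\sigma$. Then (1) $\alpha(\sigma)\circ\alpha=\alpha\circ\sigma$; (2) $\alpha(\sigma)=\overline{\alpha}\circ\sigma\circ\overline{\alpha}^{-1}$.
   Context: $V$ is a countably infinite set of variables. A substitution maps variables to terms with finite active domain $\mathrm{Dom}(\theta)=\{x:\theta(x)\neq x\}$, extended homomorphically to terms; $(\theta\circ\sigma)(x)=\theta(\sigma(x))$; $\mathrm{vars}(\theta)=\mathrm{Dom}(\theta)\cup\mathrm{vars}(\theta(\mathrm{Dom}(\theta)))$. A renaming is a bijective substitution mapping variables to variables; $\rho^{-1}$ is its inverse. A prenaming is a substitution $\alpha$ mapping variables to variables together with a fixed finite set $C^+(\alpha)\supseteq\mathrm{Dom}(\alpha)$ (relaxed core) on which $\alpha$ is injective; $R^+(\alpha)=\alpha(C^+(\alpha))$. $\mathrm{indom}(\alpha)=V\setminus(R^+(\alpha)\setminus C^+(\alpha))$; $\alpha$ is safe for $\sigma$ if $\mathrm{vars}(\sigma)\subseteq\mathrm{indom}(\alpha)$. The substitution variant is $\alpha(\sigma):=\{\alpha(x)/\alpha(\sigma(x)):x\in\mathrm{Dom}(\sigma)\}$, the substitution sending $\alpha(x)$ to $\alpha(\sigma(x))$ for $x\in\mathrm{Dom}(\sigma)$ and identity elsewhere. The closure $\overline{\alpha}$ of $\alpha$ (a renaming) is defined by: $\overline{\alpha}(x)=\alpha(x)$ for $x\in C^+(\alpha)$; for $x\in R^+(\alpha)\setminus C^+(\alpha)$, $\overline{\alpha}(x)=z$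 where $z$ is the start of the maximal chain $z,\alpha(z),\dots,\alpha^m(z)=x$ with $z,\dots,\alpha^{m-1}(z)\in C^+(\alpha)$; $\overline{\alpha}(x)=x$ outside $C^+(\alpha)\cup R^+(\alpha)$.
   Formalization: Part (1) is asserted only at variables x in indom(α) or outside Dom(α(σ)), exactly where it holds; on all of V it fails, e.g. α={0↦1}, C⁺(α)={0}, σ={0/2} at x=1, where the sides are 2 and 1. *)

(* Defs.v *)
From HB Require Import structures.
From mathcomp Require Import all_boot finmap.

Set Implicit Arguments.
Unset Strict Implicit.
Unset Printing Implicit Defensive.

Local Open Scope fset_scope.

(* First-order terms over the ranked signature (F, ar). *)
Inductive term (V : Type) (F : Type) (ar : F -> nat) : Type :=
| Var of V
| App (f : F) of {ffun 'I_(ar f) -> term V ar}.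

Arguments Var {V F ar} _.
Arguments App {V F ar} f _.

Section TermEq.
Variables (V F : eqType) (ar : F -> nat).

Fixpoint eq_term (s t : term V ar) {struct s} : bool :=
  match s, t with
  | Var x, Var y => x == y
  | App f ss, App g ts =>
      match f =P g with
      | ReflectT e => [forall i, eq_term (ss i) (ts (cast_ord (congr1 ar e) i))]
      | ReflectF _ => false
      end
  | _, _ => false
  end.

Lemma eq_termP : Equality.axiom eq_term.
Proof.
move=> s t; apply: (iffP idP) => [|<-].
  move: s t; fix IH 1 => -[x|f ss] [y|g ts] //=; first by move/eqP->.
  case: eqP => // e; case: _ / e ts => ts /= /forallP h; congr App.
  by apply/ffunP=> i; apply: IH; have := h i; rewrite cast_ord_id.
move: s; fix IH 1 => -[x|f ss] //=.
case: eqP => // e; apply/forallP => i.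
rewrite (_ : cast_ord _ i = i); first exact: IH.
exact: val_inj.
Qed.

HB.instance Definition _ := hasDecEq.Build (term V ar) eq_termP.

End TermEq.

(* The equality and the support of {fsfun _} are extensional: two substitutions
   are equal iff they agree on all variables, and [finsupp] is exactly the
   active domain {x : theta(x) <> x}. *)
Definition subst (V : choiceType) (F : eqType) (ar : F -> nat) :=
  {fsfun V -> term V ar for Var}.

Section Substitutions.
Variables (V : choiceType) (F : eqType) (ar : F -> nat).
Local Notation term := (term V ar).
Local Notation subst := (subst V ar).
Implicit Types (t : term) (theta sigma : subst) (f : {fsfun V -> V}).

Fixpoint vars t : {fset V} :=
  match t with
  | Var x => [fset x]
  | App f ts => \big[fsetU/fset0]_i vars (ts i)
  end.

Fixpoint tsubst theta t : term :=
  match t with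
  | Var x => theta x
  | App f ts => App f [ffun i => tsubst theta (ts i)]
  end.

Definition scomp theta sigma : subst :=
  [fsfun x in finsupp sigma `|` finsupp theta => tsubst theta (sigma x)].

Lemma scompE theta sigma x : scomp theta sigma x = tsubst theta (sigma x).
Proof.
rewrite /scomp fsfunE in_fsetU; case: finsuppP => //= xs.
by case: finsuppP.
Qed.

Definition svars theta : {fset V} :=
  finsupp theta `|` \bigcup_(x <- finsupp theta) vars (theta x).

(* Substitutions mapping variables to variables are represented by the induced
   finitely supported maps V -> V; [vsubst] is the substitution itself. *)
Definition vsubst f : subst := [fsfun x in finsupp f => Var (f x)].

Lemma vsubstE f x : vsubst f x = Var (f x).
Proof. by rewrite /vsubst fsfunE; case: finsuppP. Qed.

End Substitutions.

Arguments vsubst {V F ar} f.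

Record renaming (V : choiceType) := Renaming {
  ren_map :> {fsfun V -> V};
  ren_bij : bijective ren_map }.

Section RenamingInverse.
Variables (V : choiceType) (rho : renaming V).

Definition ren_inv_fun (y : V) : V :=
  if [pick x : finsupp rho | rho (val x) == y] is Some x then val x else y.

Definition ren_inv_map : {fsfun V -> V} :=
  [fsfun y in finsupp rho => ren_inv_fun y].

Let rho_inj : injective rho := bij_inj (ren_bij rho).

Lemma ren_supp x : (rho x \in finsupp rho) = (x \in finsupp rho).
Proof. by rewrite !mem_finsupp (inj_eq rho_inj). Qed.

Lemma ren_mapK : cancel rho ren_inv_map.
Proof.
move=> x; rewrite /ren_inv_map fsfunE ren_supp; case: ifPn => xs.
  rewrite /ren_inv_fun; case: pickP => [y /eqP /rho_inj //|].
  by move=> /(_ [` xs]); rewrite eqxx.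
by rewrite fsfun_dflt.
Qed.

Lemma ren_mapVK : cancel ren_inv_map rho.
Proof. by move=> y; case: (ren_bij rho) => g _ gK; rewrite -(gK y) ren_mapK. Qed.

Definition ren_inv : renaming V := Renaming (Bijective ren_mapVK ren_mapK).

End RenamingInverse.

Record prenaming (V : choiceType) := Prenaming {
  pre_map :> {fsfun V -> V};
  core : {fset V};
  core_supp : finsupp pre_map `<=` core;
  core_inj : {in core &, injective pre_map} }.

Section Prenamings.
Variables (V : choiceType) (alpha : prenaming V).
Local Notation C := (core alpha).

Definition range : {fset V} := alpha @` C.
Local Notation R := range.

Definition indom : pred V := [pred x | x \notin R `\` C].

(* z, alpha z, ..., alpha^m z = x is a chain ending in x whose elements before
   x lie in the relaxed core. *)
Definition chain (z : V) (m : nat) (x : V) : bool :=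
  all (fun i => iter i alpha z \in C) (iota 0 m) && (iter m alpha z == x).

(* A chain is maximal when its start z has no predecessor in the relaxed core,
   i.e. z is not in R. For x outside C the elements of a chain before x are
   pairwise distinct, so bounding m by the cardinality of C loses nothing, see
   [chain_bound]. *)
Definition chain_start (x z : V) : bool :=
  [exists m : 'I_#|` C|.+1, chain z m x] && (z \notin R).

Definition closure_fun (x : V) : V :=
  if x \in C then alpha x else
  if x \in R then
    if [pick z : C | chain_start x (val z)] is Some z then val z else x
  else x.

Definition closure_map : {fsfun V -> V} := [fsfun x in C `|` R => closure_fun x].

Lemma closure_mapE x : closure_map x = closure_fun x.
Proof.
rewrite /closure_map fsfunE in_fsetU /closure_fun.
by case: (x \in C) => //=; case: (x \in R).
Qed.

Lemma chainP z m x :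
  reflect ((forall i, i < m -> iter i alpha z \in C) /\ iter m alpha z = x)
          (chain z m x).
Proof.
apply: (iffP andP) => [[/allP h /eqP e]|[h e]]; split=> //.
- by move=> i im; apply: h; rewrite mem_iota.
- by apply/allP=> i; rewrite mem_iota; apply: h.
- exact/eqP.
Qed.

Lemma chain_bound z m x : x \notin C -> chain z m x -> m <= #|` C|.
Proof.
move=> xC /chainP[h e].
have ltdist i j : i < j -> j < m -> iter i alpha z != iter j alpha z.
  move=> ij jm; apply/eqP=> eij; case/negP: xC.
  rewrite -e -(subnK (ltnW jm)) iterD -eij -iterD; apply: h.
  by rewrite -[X in _ < X](subnK (ltnW jm)) ltn_add2l.
have u : uniq [seq iter i alpha z | i <- iota 0 m].
  rewrite map_inj_in_uniq ?iota_uniq // => i j; rewrite !mem_iota /= => im jm eij.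
  case: (ltngtP i j) => // /ltdist; first by move/(_ jm); rewrite eij eqxx.
  by move/(_ im); rewrite eij eqxx.
have := uniq_leq_size u; rewrite size_map size_iota; apply.
by move=> y /mapP[i]; rewrite mem_iota => /h hi ->.
Qed.

Lemma chain_start_ex x : x \in R -> x \notin C ->
  exists2 z, z \in C & chain_start x z.
Proof.
move=> xR xC.
pose P m := [exists z : C, (0 < m) && chain (val z) m x].
have P1 : exists m, P m.
  case/imfsetP: xR => y /= yC xy; exists 1; apply/existsP; exists [` yC] => /=.
  by apply/chainP; split=> // -[].
have Pb m : P m -> m <= #|` C|.
  by case/existsP=> z /andP[_]; apply: chain_bound.
case: (ex_maxnP P1 Pb) => m /existsP[z /andP[m0 cz]] mmax.
exists (val z); first exact: valP.
apply/andP; split.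
  apply/existsP; have := chain_bound xC cz; rewrite -ltnS => mb.
  by exists (Ordinal mb).
apply/negP=> /imfsetP[y /= yC zy].
suff /mmax : P m.+1 by rewrite ltnn.
apply/existsP; exists [` yC] => /=; apply/chainP.
case/chainP: cz => h e; split; last by rewrite iterSr -zy.
by case=> // i im; rewrite iterSr -zy h.
Qed.

Lemma closure_funRC x : x \in R -> x \notin C ->
  [/\ closure_fun x \in C, closure_fun x \notin R &
      exists m, chain (closure_fun x) m x].
Proof.
move=> xR xC; rewrite /closure_fun (negPf xC) xR.
case: pickP => [z /andP[/existsP[m cm] zR]|h].
  by split=> //; [exact: valP | exists m].
have [z zC hz] := chain_start_ex xR xC.
by have := h [` zC]; rewrite /= hz.
Qed.

Lemma closure_funC x : x \in C -> closure_fun x \in R.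
Proof. by move=> xC; rewrite /closure_fun xC; apply: in_imfset. Qed.

Lemma closure_fun_out x : x \notin C -> x \notin R -> closure_fun x = x.
Proof. by rewrite /closure_fun => /negPf-> /negPf->. Qed.


Lemma closure_fun_inj : injective closure_fun.
Proof.
move=> x y.
case xC: (x \in C); case yC: (y \in C).
- by rewrite /closure_fun xC yC; apply: core_inj.
- have := closure_funC xC => + e; rewrite e.
  case yR: (y \in R); last by rewrite closure_fun_out ?yC ?yR.
  by have [_ /negPf->] := closure_funRC yR (negbT yC).
- have := closure_funC yC => + e; rewrite -e.
  case xR: (x \in R); last by rewrite closure_fun_out ?xC ?xR.
  by have [_ /negPf->] := closure_funRC xR (negbT xC).
case xR: (x \in R); case yR: (y \in R).
- have [_ _ [m /chainP[hx ex]]] := closure_funRC xR (negbT xC).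
  have [_ _ [n /chainP[hy ey]]] := closure_funRC yR (negbT yC).
  move=> e; rewrite -e in hy ey.
  case: (ltngtP m n) => [/hy|/hx|mn]; rewrite ?ex ?ey ?xC ?yC //.
  by rewrite -ex -ey mn.
- have [cC _ _] := closure_funRC xR (negbT xC) => e; move: cC.
  by rewrite e closure_fun_out ?yC ?yR.
- have [cC _ _] := closure_funRC yR (negbT yC) => e; move: cC.
  by rewrite -e closure_fun_out ?xC ?xR.
- by rewrite !closure_fun_out ?xC ?xR ?yC ?yR.
Qed.

Lemma closure_fun_stable x : x \in C `|` R -> closure_fun x \in C `|` R.
Proof.
rewrite !in_fsetU; case xC: (x \in C); first by rewrite closure_funC // orbT.
by move=> /= xR; have [->] := closure_funRC xR (negbT xC).
Qed.

Lemma closure_bij : bijective closure_map.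
Proof.
pose S := C `|` R.
pose g (x : S) : S := [` closure_fun_stable (valP x)].
have g_inj : injective g.
  by move=> x y /(congr1 val) /closure_fun_inj /val_inj.
pose h y := if insub y is Some y' then val (invF g_inj y') else y.
exists h => x; rewrite closure_mapE.
  case xS: (x \in S).
    rewrite /h insubT ?closure_fun_stable // => xS'.
    rewrite (_ : Sub _ _ = g [` xS]) ?invF_f //.
    exact: val_inj.
  move: (xS); rewrite in_fsetU => /norP[xC xR].
  by rewrite closure_fun_out // /h insubF.
rewrite /h; case: insubP => [y' _ <-|xS].
  by rewrite -[in RHS](f_invF g_inj y').
by move: xS; rewrite in_fsetU => /norP[xC xR]; rewrite closure_fun_out.
Qed.

Definition pclosure : renaming V := Renaming closure_bij.

End Prenamings.

Section Variants.
Variables (V : choiceType) (F : eqType) (ar : F -> nat).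
Implicit Types (alpha : prenaming V) (sigma : subst V ar).

Definition safe alpha sigma : Prop := {subset svars sigma <= indom alpha}.

(* The bindings alpha(x) / alpha(sigma(x)), x in Dom(sigma); a prenaming safe
   for sigma is injective on Dom(sigma), so that [pick] has no choice. *)
Definition variant alpha sigma : subst V ar :=
  [fsfun y in alpha @` finsupp sigma =>
    if [pick x : finsupp sigma | alpha (val x) == y] is Some x
    then tsubst (vsubst alpha) (sigma (val x)) else Var y].

Lemma indom_inj alpha : {in indom alpha &, injective alpha}.
Proof.
have out z : z \notin core alpha -> alpha z = z.
  move=> zC; apply: fsfun_dflt.
  by apply: contra zC => /(fsubsetP (core_supp alpha)).
have mix x y : x \in core alpha -> y \notin core alpha ->
    y \in indom alpha -> alpha x <> alpha y.
  move=> xC yC; rewrite inE in_fsetD yC /= (out _ yC) => /negP yR e.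
  by apply: yR; rewrite -e; apply: in_imfset.
move=> x y xi yi; case xC: (x \in core alpha); case yC: (y \in core alpha).
- exact: core_inj.
- by move=> /mix; rewrite xC yC; case.
- by move=> /esym /mix; rewrite xC yC; case.
- by rewrite !out ?xC ?yC.
Qed.

Lemma variantE alpha sigma x : safe alpha sigma -> x \in finsupp sigma ->
  variant alpha sigma (alpha x) = tsubst (vsubst alpha) (sigma x).
Proof.
move=> sf xs; rewrite /variant fsfunE in_imfset //.
have si z : z \in finsupp sigma -> z \in indom alpha.
  by move=> zs; apply: sf; rewrite in_fsetU zs.
case: pickP => [z /eqP /indom_inj e|/(_ [` xs])]; last by rewrite eqxx.
by rewrite e ?si ?(valP z).
Qed.

End Variants.

(* Main.v *)
Require Import Defs.
From mathcomp Require Import all_boot finmap.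

(** A prenaming [alpha] and its closure agree on [indom alpha], hence on all the
    variables of [sigma] when [alpha] is safe for [sigma]. As the closure is
    injective, a variable [pclosure alpha x] is bound by the variant of [sigma]
    iff [x] is bound by [sigma]; both claims follow variable by variable. *)

Set Implicit Arguments.
Unset Strict Implicit.
Unset Printing Implicit Defensive.

Local Open Scope fset_scope.

Section TermSubstitution.
Variables (V : choiceType) (F : eqType) (ar : F -> nat).
Implicit Types (theta sigma : subst V ar) (t : term V ar).

Lemma vars_App f (ts : {ffun 'I_(ar f) -> term V ar}) i :
  vars (ts i) `<=` vars (App f ts).
Proof. by rewrite /= (bigD1 i) //= fsubsetUl. Qed.

Lemma eq_in_tsubst theta sigma t :
  {in vars t, theta =1 sigma} -> tsubst theta t = tsubst sigma t.
Proof.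
move: t; fix IH 1 => -[x|f ts] eq_ts; first by apply: eq_ts; rewrite /= in_fset1.
congr App; apply/ffunP => i; rewrite !ffunE; apply: IH => x xi.
exact: eq_ts (fsubsetP (vars_App ts i) x xi).
Qed.

Lemma vars_svars sigma x :
  x \in finsupp sigma -> vars (sigma x) `<=` svars sigma.
Proof.
move=> xs; apply: fsubset_trans (fsubsetUr _ _).
exact: (bigfcup_sup (fun z => vars (sigma z))) xs isT.
Qed.

End TermSubstitution.

Section Variants.
Variables (V : choiceType) (F : eqType) (ar : F -> nat).
Implicit Types (alpha : prenaming V) (sigma : subst V ar).

Lemma prenaming_out alpha x : x \notin core alpha -> alpha x = x.
Proof.
by move=> xC; apply: fsfun_dflt; apply: contra xC; apply/fsubsetP/core_supp.
Qed.

(** The two maps can differ only on the range minus the core, which is what [indom] removes; outside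
    core and range both are the identity. *)
Lemma pclosure_indom alpha : {in indom alpha, pclosure alpha =1 alpha}.
Proof.
move=> x; rewrite /= closure_mapE /closure_fun inE in_fsetD.
by case: ifPn => //= xC /negPf ->; rewrite prenaming_out.
Qed.

Lemma safe_finsupp alpha sigma :
  safe alpha sigma -> {subset finsupp sigma <= indom alpha}.
Proof. by move=> sf x xs; apply: sf; rewrite in_fsetU xs. Qed.

Lemma tsubst_pclosure alpha sigma x : safe alpha sigma ->
  x \in finsupp sigma ->
  tsubst (vsubst (pclosure alpha)) (sigma x) = tsubst (vsubst alpha) (sigma x).
Proof.
move=> sf xs; apply: eq_in_tsubst => z zx.
by rewrite !vsubstE pclosure_indom //; apply/sf/(fsubsetP (vars_svars xs)).
Qed.

Lemma variant_out alpha sigma y :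
  y \notin alpha @` finsupp sigma -> variant alpha sigma y = Var y.
Proof. by rewrite /variant fsfunE => /negPf ->. Qed.

(** Extends [variantE] to unbound [x]: [alpha] is injective on [indom alpha], which contains the
    domain of [sigma], so [alpha x] is not the image of a bound variable. *)
Lemma variant_indom alpha sigma x : safe alpha sigma -> x \in indom alpha ->
  variant alpha sigma (alpha x) = tsubst (vsubst alpha) (sigma x).
Proof.
move=> sf xi; have [xs|xs] := boolP (x \in finsupp sigma); first exact: variantE.
rewrite (fsfun_dflt xs) /= vsubstE variant_out //.
apply: contra xs => /imfsetP[z /= zs /indom_inj -> //].
exact: safe_finsupp zs.
Qed.

(** No condition on [x] remains, because the closure is injective everywhere. *)
Lemma variant_pclosure alpha sigma x : safe alpha sigma ->
  variant alpha sigma (pclosure alpha x) =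
  tsubst (vsubst (pclosure alpha)) (sigma x).
Proof.
move=> sf; have sfs := safe_finsupp sf.
have [xs|xs] := boolP (x \in finsupp sigma).
  by rewrite tsubst_pclosure // pclosure_indom ?sfs // variantE.
rewrite (fsfun_dflt xs) [RHS]/= vsubstE variant_out //.
(* A bound [z] lies in [indom alpha], so [alpha z] is [pclosure alpha z] and injectivity of the
   closure gives [z = x]. *)
apply: contra xs => /imfsetP[z /= zs]; rewrite -(pclosure_indom (sfs z zs)).
by move/(bij_inj (ren_bij (pclosure alpha))) => ->.
Qed.

End Variants.

(** The guard in the first claim is sharp: for [x] outside [indom alpha] the right-hand side is
    [Var x] and the left-hand side is the variant at [x], which differs when [x] is [alpha z] for
    some bound [z] with [sigma z <> Var z]. *)
Theorem mainTheorem5 (V : countType) (V_inf : forall s : {fset V}, exists x : V, x \notin s)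
    (F : eqType) (ar : F -> nat)
    (sigma : subst V ar) (alpha : prenaming V) (alpha_safe : safe alpha sigma) :
  (forall x : V, x \in indom alpha \/ x \notin finsupp (variant alpha sigma) ->
     scomp (variant alpha sigma) (vsubst alpha) x = scomp (vsubst alpha) sigma x)
  /\
  variant alpha sigma =
    scomp (vsubst (pclosure alpha))
          (scomp sigma (vsubst (ren_inv (pclosure alpha)))).
Proof.
split=> [x xP|].
  rewrite !scompE vsubstE /=; have [xi|xi] := boolP (x \in indom alpha).
    exact: variant_indom.
  case: xP => [|xv]; first by rewrite (negPf xi).
  (* Here [x] is in the range but not in the core: safety leaves it unbound in [sigma], and [alpha]
     fixes it. *)
  have xs : x \notin finsupp sigma.
    by apply: contra xi; apply: safe_finsupp.
  have xC : x \notin core alpha by move: xi; rewrite inE negbK in_fsetD => /andP[].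
  by rewrite (fsfun_dflt xs) /= vsubstE prenaming_out // fsfun_dflt.
apply/fsfunP => y; rewrite !scompE vsubstE /=.
(* Every [y] is the closure's image of its inverse image, so [variant_pclosure] covers all
   variables. *)
by rewrite -{1}(ren_mapVK (pclosure alpha) y) variant_pclosure.
Qed.
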